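(* For every real number $\epsilon$ with $0 < \epsilon \leq 1$, there exists $t_\epsilon$ such that every finite simple graph $G$ with $\Delta_\epsilon(G) \geq t_\epsilon$ satisfies \[\chi(G) \leq \max\{\omega(G), \Delta_\epsilon(G)\}.\]
   Context: For a graph $G$, $d(v)$ denotes the degree of vertex $v$, $\chi(G)$ the chromatic number and $\omega(G)$ the clique number. For $0 \leq \epsilon \leq 1$, \[\Delta_\epsilon(G) = \left\lfloor \max_{xy \in E(G)} \Big( (1-\epsilon)\min\{d(x), d(y)\} + \epsilon \max\{d(x), d(y)\} \Big) \right\rfloor.\] *)

(* Defs.v *)
From mathcomp Require Import all_boot all_order all_algebra.
From mathcomp Require Import reals.
Set Implicit Arguments. Unset Strict Implicit. Unset Printing Implicit Defensive.
Import Order.TTheory GRing.Theory Num.Theory.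

Definition simple_graph (T : finType) (e : rel T) : Prop :=
  symmetric e /\ irreflexive e.

Definition deg (T : finType) (e : rel T) (v : T) : nat := #|[set u | e v u]|.

Definition proper_coloring (T : finType) (e : rel T) (k : nat) (c : T -> 'I_k) : bool :=
  [forall x, forall y, e x y ==> (c x != c y)].

Definition colorable (T : finType) (e : rel T) (k : nat) : bool :=
  [exists c : {ffun T -> 'I_k}, proper_coloring e c].

(* chromatic number: the least k admitting a proper k-colouring
   (k = #|T| always works, so the least such k is <= #|T|). *)
Definition chi (T : finType) (e : rel T) : nat :=
  \max_(k < #|T|.+1 | colorable e k && [forall j : 'I_k, ~~ colorable e j]) k.

Definition clique (T : finType) (e : rel T) (S : {set T}) : bool :=
  [forall x in S, forall y in S, (x != y) ==> e x y].

Definition omega (T : finType) (e : rel T) : nat :=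
  \max_(S : {set T} | clique e S) #|S|.

Local Open Scope ring_scope.

(* Delta_eps(G) = floor( max over edges xy of
     (1-eps) min(d x, d y) + eps max(d x, d y) ).
   Since the inner values are nonnegative, the floor of the max equals the
   max of the floors; an edgeless graph gets value 0. *)
Definition Delta_eps (R : realType) (eps : R) (T : finType) (e : rel T) : nat :=
  (\max_(p : T * T | e p.1 p.2)
     Num.truncn ((1 - eps) * (minn (deg e p.1) (deg e p.2))%:R
                 + eps * (maxn (deg e p.1) (deg e p.2))%:R))%N.

(* Main.v *)
(* Suppose G is not k-colorable, where k is the maximum of omega and Delta_eps,
   and pass to a vertex-critical induced subgraph.  There all degrees are at
   least k and at most k + C with C = floor(1/eps), and the high vertices (those
   of degree > k) are independent.

   Uncolor one vertex x and split the k color classes of the rest into C + 1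
   parts of at least three colors each, choosing x and the splitting so that as
   few edges as possible lie inside parts.  By a Brooks argument, adding x to a
   part in which it has as few neighbours as it can completes a clique, and any
   vertex of that clique can be uncolored in place of x.  Since the excess degree
   of x is at most C, one of the C + 1 parts allows exchanging x for a low
   vertex.  For low x, moving the uncolored vertex back and forth between two
   parts (Mozhan) shows that the closed neighbourhood of x is a clique up to
   non-adjacent pairs of high vertices.  With at most one high vertex this is a
   clique on k + 1 > omega vertices.  With two of them, color the rest of G, give
   both the same color, and complete the k-coloring greedily. *)

Require Import Defs.
From mathcomp Require Import all_boot all_order all_algebra.
From mathcomp Require Import boolp reals zify lra.
Set Implicit Arguments.
Unset Strict Implicit.
Unset Printing Implicit Defensive.
Import Order.TTheory GRing.Theory Num.Theory.

(** * Colorings of vertex sets: greedy extension, gluing, Brooks *)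

Section SetColoring.
Variables (T : finType) (e : rel T).
Hypotheses (e_sym : symmetric e) (e_irr : irreflexive e).

Implicit Types (W A B Z S : {set T}) (c : T -> nat) (n r : nat).

Definition nbr v W : {set T} := [set u in W | e v u].

(** A coloring is a total function constrained only on [W], so that restricting, extending and
    gluing never change its type. *)
Definition proper_on W n c : Prop :=
  (forall v, v \in W -> c v < n) /\
  (forall u v, u \in W -> v \in W -> e u v -> c u <> c v).

Definition set_colorable W n : Prop := exists c, proper_on W n c.

Lemma nbr_sub v A B : A \subset B -> #|nbr v A| <= #|nbr v B|.
Proof.
move=> sAB; apply/subset_leq_card/subsetP=> u; rewrite !inE => /andP[uA ->].
by rewrite (subsetP sAB).
Qed.

Lemma neq_of_adj u v : e u v -> u != v.
Proof. by apply: contraTneq => ->; rewrite e_irr. Qed.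

Lemma proper_on_sub A B n c : A \subset B -> proper_on B n c -> proper_on A n c.
Proof.
move=> /subsetP sAB [cn cp]; split=> [v /sAB|u v /sAB uB /sAB vB]; first exact: cn.
exact: cp.
Qed.

Lemma set_colorable_sub A B n :
  A \subset B -> set_colorable B n -> set_colorable A n.
Proof. by move=> sAB [c cP]; exists c; apply: proper_on_sub cP. Qed.

Lemma free_color n (s : seq nat) : size s < n -> exists2 i, i < n & i \notin s.
Proof.
move=> sn; case: (boolP (all (mem s) (iota 0 n))) => [/allP sub|].
  have : size (iota 0 n) <= size s by apply: uniq_leq_size (iota_uniq 0 n) sub.
  by rewrite size_iota leqNgt sn.
by case/allPn=> i; rewrite mem_iota => /andP[_ ilt] ins; exists i.
Qed.

Lemma recolor W n c u i : proper_on W n c -> i < n ->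
  (forall v, v \in W -> e u v -> c v <> i) ->
  proper_on (u |: W) n (fun v => if v == u then i else c v).
Proof.
move=> [cn cp] ilt ifree; split=> [v|v w]; rewrite !inE.
  by case: eqP => //= _ /cn.
case: (eqVneq v u) => [->|_] /=; case: (eqVneq w u) => [->|_] //=.
- by rewrite e_irr.
- by move=> _ wW uw h; apply: (ifree w).
- by move=> vW _ vu h; apply: (ifree v) => //; rewrite e_sym.
- exact: cp.
Qed.

Lemma extend_vertex W n c u : proper_on W n c -> u \notin W ->
  (exists2 i, i < n & forall v, v \in W -> e u v -> c v <> i) ->
  exists2 c', proper_on (u |: W) n c' & forall v, v \in W -> c' v = c v.
Proof.
move=> cP uW [i ilt ifree]; exists (fun v => if v == u then i else c v).
  exact: recolor.
by move=> v vW; case: eqP vW => // ->; rewrite (negbTE uW).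
Qed.

Lemma free_color_nbr W n c u :
  #|nbr u W| < n \/
  #|nbr u W| <= n /\ 0 < n /\ (exists t1 t2, [/\ t1 \in nbr u W, t2 \in nbr u W, t1 != t2 & c t1 = c t2]) ->
  exists2 i, i < n & forall v, v \in W -> e u v -> c v <> i.
Proof.
move=> H.
have [N [sN /free_color[i ilt iN]]] : exists N : seq nat,
    (forall v, v \in nbr u W -> c v \in N) /\ size N < n.
  case: H => [lt|[le [n0 [t1 [t2 [h1 h2 t12 c12]]]]]].
    exists [seq c v | v in nbr u W]; split=> [v vN|]; first exact: image_f.
    by rewrite size_image.
  exists [seq c v | v in nbr u W :\ t2]; split=> [v vN|].
    case: (eqVneq v t2) => [->|vt].
      by rewrite -c12; apply: image_f; rewrite in_setD1 t12.
    by apply: image_f; rewrite in_setD1 vt.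
  by rewrite size_image; have := cardsD1 t2 (nbr u W); rewrite h2; lia.
exists i => // v vW uv; apply: contraNnot iN => <-; apply: sN.
by rewrite inE vW.
Qed.

(* The second alternative lets a vertex see n colored neighbours when two of
   them share a color. *)
Lemma extend_set W (S : {set T}) n c : proper_on W n c -> 0 < n ->
  (forall u, u \in S -> u \notin W) ->
  (forall u, u \in S -> #|nbr u (W :|: S)| < n \/
     #|nbr u (W :|: S)| <= n /\
     exists t1 t2, [/\ t1 \in nbr u W, t2 \in nbr u W, t1 != t2 & c t1 = c t2]) ->
  exists2 c', proper_on (W :|: S) n c' & forall v, v \in W -> c' v = c v.
Proof.
move=> cP n0; elim: {S}_.+1 {-2}S (ltnSn #|S|) => // m IH S Sm SW Sdeg.
case: (set_0Vmem S) => [->|[u uS]]; first by rewrite setU0; exists c.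
have sub : W :|: (S :\ u) \subset W :|: S by rewrite setUS // subsetDl.
have [||v|c1 c1P c1E] := IH (S :\ u).
- by have := cardsD1 u S; rewrite uS; lia.
- by move=> v; rewrite inE => /andP[_ /SW].
- rewrite inE => /andP[_ /Sdeg [lt|[le [t1 [t2 ht]]]]].
    by left; apply: leq_ltn_trans (nbr_sub _ sub) lt.
  right; split; first exact: leq_trans (nbr_sub _ sub) le.
  by exists t1, t2.
have uW1 : u \notin W :|: (S :\ u).
  by rewrite !inE eqxx /= orbF; apply: SW.
have [|c2 c2P c2E] := extend_vertex c1P uW1.
  apply: free_color_nbr; case: (Sdeg _ uS) => [lt|[le [t1 [t2 [h1 h2 t12 c12]]]]].
    by left; apply: leq_ltn_trans (nbr_sub _ sub) lt.
  right; split; first exact: leq_trans (nbr_sub _ sub) le.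
  split=> //; exists t1, t2; move: h1 h2; rewrite !inE => /andP[w1 e1] /andP[w2 e2].
  by rewrite w1 w2 e1 e2 !c1E.
exists c2.
  by rewrite (_ : _ :|: S = u |: (W :|: (S :\ u))) // setUCA setD1K.
by move=> v vW; rewrite c2E ?c1E // inE vW.
Qed.

Lemma glue A B n cA cB : proper_on A n cA -> proper_on B n cB ->
  (forall v, v \in A -> v \in B -> cA v = cB v) ->
  (forall u w, u \in A -> w \in B -> e u w -> u \in B \/ w \in A) ->
  set_colorable (A :|: B) n.
Proof.
move=> [An Ap] [Bn Bp] agr edge.
exists (fun v => if v \in A then cA v else cB v); split=> [v|u w]; rewrite !inE.
  by case: ifP => [/An//|_ /= /Bn].
case: ifP => uA; case: ifP => wA //=.
- by move=> _ _; apply: Ap.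
- move=> _ wB uw; case: (edge u w) => // uB; last by rewrite uB in wA.
  by rewrite agr //; apply: Bp.
- move=> uB _ uw; case: (edge w u) => //; first by rewrite e_sym.
    by move=> wB; rewrite agr //; apply: Bp.
  by move=> h; rewrite h in uA.
- exact: Bp.
Qed.

Definition swap (i j : nat) (x : nat) := if x == i then j else if x == j then i else x.

Lemma swap_inj i j : injective (swap i j).
Proof. by rewrite /swap => x y; do !case: eqP; lia. Qed.

Lemma proper_on_swap W n c i j : i < n -> j < n -> proper_on W n c ->
  proper_on W n (swap i j \o c).
Proof.
move=> iln jln [cn cp]; split=> [v /cn|u v uW vW uv /swap_inj]; last exact: cp.
by rewrite /= /swap; do !case: ifP.
Qed.

(* Permuting the colors of cB makes it agree with cA at a and b. *)
Lemma glue_pair A B n cA cB a b : proper_on A n cA -> proper_on B n cB ->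
  a \in A :&: B -> b \in A :&: B ->
  (forall v, v \in A -> v \in B -> v = a \/ v = b) ->
  (forall u w, u \in A -> w \in B -> e u w -> u \in B \/ w \in A) ->
  (cA a == cA b) = (cB a == cB b) ->
  set_colorable (A :|: B) n.
Proof.
rewrite !inE => PA PB /andP[aA aB] /andP[bA bB] AB edge ceq.
have [An _] := PA; have [Bn _] := PB.
pose c1 := swap (cB a) (cA a) \o cB.
have P1 : proper_on B n c1 by apply: proper_on_swap; auto.
have c1a : c1 a = cA a by rewrite /c1 /= /swap eqxx.
have ceq1 : (cA a == cA b) = (c1 a == c1 b).
  by rewrite ceq /c1 /= (inj_eq (@swap_inj _ _)).
have [B1n _] := P1.
pose c2 := swap (c1 b) (cA b) \o c1.
have P2 : proper_on B n c2 by apply: proper_on_swap; auto.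
have c2b : c2 b = cA b by rewrite /c2 /= /swap eqxx.
have c2a : c2 a = cA a.
  move: ceq1; rewrite c1a /c2 /= c1a /swap => <-; by case: eqP => // h; rewrite h.
apply: (glue PA P2) => // v vA vB.
by case: (AB v vA vB) => ->.
Qed.

(* Color D greedily towards v: each vertex other than v still has an uncolored
   neighbour when its turn comes, and v sees two vertices of equal color. *)
Lemma extend_component W (D : {set T}) n c v : 0 < n -> proper_on W n c -> v \in D ->
  (forall u, u \in D -> u \notin W) ->
  (forall S : {set T}, v \in S -> S \subset D -> ~~ (D \subset S) ->
     exists w, [/\ w \in D, w \notin S & exists2 s, s \in S & e s w]) ->
  (forall u, u \in D -> #|nbr u (W :|: D)| <= n) ->
  (exists t1 t2, [/\ t1 \in nbr v W, t2 \in nbr v W, t1 != t2 & c t1 = c t2]) ->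
  exists2 c', proper_on (W :|: D) n c' & forall u, u \in W -> c' u = c u.
Proof.
move=> n0 cP vD DW conn deg [t1 [t2 [h1 h2 t12 c12]]].
suff main m S : #|D :\: S| <= m -> v \in S -> S \subset D ->
    (exists2 c', proper_on (W :|: (D :\: S)) n c' & forall u, u \in W -> c' u = c u).
  have [||c1 c1P c1E] := main _ [set v] (leqnn _); rewrite ?set11 ?sub1set //.
  have vn : v \notin W :|: (D :\ v) by rewrite !inE eqxx /= orbF; apply: DW.
  have [|c2 c2P c2E] := extend_vertex c1P vn.
    apply: free_color_nbr; right; split.
      by apply: leq_trans (deg v vD); apply: nbr_sub; rewrite setUS // subsetDl.
    split=> //; exists t1, t2; move: h1 h2; rewrite !inE => /andP[w1 e1] /andP[w2 e2].
    by rewrite w1 w2 e1 e2 !c1E.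
  exists c2; last by move=> u uW; rewrite c2E ?c1E // inE uW.
  by rewrite (_ : W :|: D = v |: (W :|: (D :\ v))) // setUCA setD1K.
elim: m S => [|m IH] S.
  by rewrite leqn0 cards_eq0 => /eqP -> _ _; rewrite setU0; exists c.
move=> Sm vS sSD.
case: (boolP (D \subset S)) => [|nDS].
  by rewrite -setD_eq0 => /eqP ->; rewrite setU0; exists c.
have [w' [w'D w'S [s sS sw]]] := conn S vS sSD nDS.
(* [S] stays uncolored. The rest of [D :\: S] is colored before [w'], which then still has the
   uncolored neighbour [s]. *)
have [|||c1 c1P c1E] := IH (w' |: S).
- have : D :\: (w' |: S) = (D :\: S) :\ w' by rewrite setUC setDDl.
  move=> ->; have := cardsD1 w' (D :\: S); rewrite inE w'S w'D /= => E.
  by rewrite E add1n ltnS in Sm.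
- by rewrite !inE vS orbT.
- by rewrite subUset sub1set w'D.
have eqD : D :\: S = w' |: (D :\: (w' |: S)).
  apply/setP=> z; rewrite !inE; case: (eqVneq z w') => [->|] //=.
  by rewrite w'S w'D.
have wn : w' \notin W :|: (D :\: (w' |: S)) by rewrite !inE eqxx /= orbF; apply: DW.
have [|c2 c2P c2E] := extend_vertex c1P wn.
  apply: free_color_nbr; left; apply: leq_trans (deg _ w'D).
  apply: proper_card; apply/properP; split.
    by apply/subsetP=> z; rewrite !inE; case: (z \in W); case: (z \in D); rewrite ?andbF //= => /andP[].
  have sD := subsetP sSD _ sS; have /negbTE sW := DW _ sD.
  exists s; first by rewrite !inE sD orbT e_sym.
  by rewrite !inE sW sS orbT.
exists c2; last by move=> u uW; rewrite c2E ?c1E // inE uW.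
by rewrite eqD setUCA.
Qed.

(* If a and b were non-adjacent, let D be the component of v in Z minus {a, b}
   and E the rest.  Greedy coloring of D towards v gives a and b equal colors,
   so by gluing E forces them apart and D forces them together.  The latter
   needs r - 1 neighbours of each in D, hence leaves at most one in E; but then
   a and b can be recolored alike on the side of E. *)
Lemma critical_nbrs_adj Z r v a b : 2 < r -> ~ set_colorable Z r ->
  (forall y, y \in Z -> set_colorable (Z :\ y) r) ->
  (forall y, y \in Z -> #|nbr y Z| <= r) ->
  v \in Z -> a \in Z -> b \in Z -> e v a -> e v b -> a != b -> e a b.
Proof.
move=> r2 ncol crit deg vZ aZ bZ va vb ab; apply/negPn/negP => nab.
have va' := neq_of_adj va; have vb' := neq_of_adj vb.
pose D0 := Z :\ a :\ b.
pose g := [rel x y | e x y && (x \in D0) && (y \in D0)].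
pose D := [set u in D0 | connect g v u]; pose E := D0 :\: D.
have vD : v \in D by rewrite !inE va' vb' vZ connect0.
have DE u w : u \in D -> w \in E -> e u w -> False.
  rewrite inE => /andP[uD0 vu] /setDP[wD0 /negP wD] uw; apply: wD.
  rewrite inE wD0; apply: connect_trans vu (connect1 _).
  by rewrite /= uw uD0.
pose W := [set a; b].
have aD : a \notin D by rewrite !inE eqxx !andbF.
have bD : b \notin D by rewrite !inE eqxx.
have DZ u : u \in D -> u \in Z by rewrite !inE => /andP[/and3P[]].
have EZ u : u \in E -> u \in Z by rewrite !inE => /andP[_ /and3P[]].
have unionZ : (W :|: D) :|: (W :|: E) = Z.
  apply/setP=> u; rewrite !inE.
  case: (eqVneq u a) => [->|ua]; first by rewrite aZ.
  case: (eqVneq u b) => [->|ub]; first by rewrite bZ.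
  by rewrite /=; case: (u \in Z); case: connect.
have HG cA cB : proper_on (W :|: D) r cA -> proper_on (W :|: E) r cB ->
    (cA a == cA b) = (cB a == cB b) -> False.
  move=> PA PB ceq; apply: ncol; rewrite -unionZ.
  apply: (glue_pair (a := a) (b := b) PA PB) => //; rewrite ?inE ?eqxx ?orbT //.
    move=> u; rewrite in_setU => /orP[|uD]; first by rewrite !inE => /orP[]/eqP; auto.
    rewrite in_setU => /orP[|]; first by rewrite !inE => /orP[]/eqP; auto.
    by rewrite in_setD uD.
  move=> u w; rewrite !in_setU => /orP[->|uD]; first by left.
  move=> /orP[->|wE] uw; first by right.
  by case: (DE u w).
have W0 : proper_on W r (fun=> 0).
  split=> [u _|u w]; first exact: ltnW (ltnW r2).
  rewrite !inE => /orP[]/eqP-> /orP[]/eqP->; rewrite ?e_irr ?(negbTE nab) //.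
  by rewrite e_sym (negbTE nab).
have [||||cA PA cAE] := extend_component (ltnW (ltnW r2)) W0 vD.
- by move=> u uD; rewrite !inE; apply/norP; split; apply: contraTneq uD => ->.
- move=> S vS SD /subsetPn[w wD wS].
  have [_ /connectP[p]] := setIdP wD.
  elim: p (v) vS => [|y p IHp] x xS /=; first by move=> _ wx; rewrite wx xS in wS.
  move=> /andP[/andP[/andP[xy xD0] yD0] pth] lst.
  case: (boolP (y \in S)) => yS; first exact: (IHp y).
  exists y; split=> //; last by exists x.
  rewrite inE yD0; have /setIdP[_ vx] := subsetP SD _ xS.
  by apply: connect_trans vx (connect1 _); rewrite /= xy xD0.
- move=> u uD; apply: leq_trans (deg u (DZ u uD)); apply: nbr_sub.
  by rewrite -unionZ subsetUl.
- by exists a, b; rewrite !inE va vb !eqxx ?orbT.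
have cAa : cA a = 0 by rewrite cAE // !inE eqxx.
have cAb : cA b = 0 by rewrite cAE // !inE eqxx orbT.
have [cB PB] : set_colorable (W :|: E) r.
  apply: set_colorable_sub (crit v vZ); apply/subsetP=> u; rewrite in_setD1.
  have vE : v \notin E by rewrite in_setD vD.
  rewrite in_setU => /orP[|uE]; last by rewrite EZ // andbT; apply: contraNneq vE => <-.
  by rewrite !inE => /orP[]/eqP->; rewrite ?aZ ?bZ eq_sym ?va' ?vb'.
have cBab : (cB a == cB b) = false.
  by apply/negP => h; apply: (HG cA cB) => //; rewrite cAa cAb h.
have degE x y : W = [set x; y] -> x \in Z -> x != y -> ~~ e x y -> x \notin D -> y \notin D ->
     cA y = 0 -> (forall c, proper_on (W :|: D) r c -> c x != c y -> False) -> #|nbr x E| <= 1.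
  move=> WE xZ xy nxy xD yD cAy HGx.
  have degZ : #|nbr x D| + #|nbr x E| <= r.
    apply: leq_trans (deg x xZ); rewrite -cardsUI.
    have -> : nbr x D :&: nbr x E = set0.
      apply/setP=> u; rewrite in_set0; apply/negP => /setIP[]; rewrite !(in_set, in_setD).
      by case/andP=> -> _ /andP[].
    rewrite cards0 addn0; apply/subset_leq_card/subsetP=> u; rewrite !in_setU.
    by rewrite !inE => /orP[]/andP[h ->]; rewrite andbT; [apply: DZ | apply: EZ]; rewrite !inE.
  case: (leqP r.-1 #|nbr x D|) => [leD|ltD].
    by move: degZ leD r2; clear; lia.
  (* Fewer than [r - 1] neighbours in [D] leave [x] a color other than the color [0] of [y], which
     [HGx] excludes. *)
  have [|i ilt inot] := @free_color r (0 :: [seq cA u | u in nbr x D]).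
    by rewrite /= size_image; move: ltD r2; clear; lia.
  move: inot; rewrite inE => /norP[i0 inot].
  have PA1 : proper_on (W :|: D) r (fun u => if u == x then i else cA u).
    have -> : W :|: D = x |: (W :|: D) by rewrite WE !setUA setUid.
    apply: recolor => // u; rewrite WE !in_setU !in_set1 -orbA.
    case/or3P=> [/eqP->|/eqP->|uD]; rewrite ?e_irr ?(negbTE nxy) // => xu cu.
    by move/negP: inot; apply; rewrite -cu; apply: image_f; rewrite inE uD.
  by case: (HGx _ PA1); rewrite eqxx (eq_sym y x) (negbTE xy) cAy.
have degEa : #|nbr a E| <= 1.
  by apply: (degE a b) => // c Pc /negbTE h; apply: (HG c cB); rewrite ?h.
have degEb : #|nbr b E| <= 1.
  apply: (degE b a) => //; first by rewrite setUC.
  - by rewrite eq_sym.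
  - by rewrite e_sym.
  - by move=> c Pc /negbTE h; apply: (HG c cB); rewrite // eq_sym h.
have [|i ilt] := @free_color r ([seq cB u | u in nbr a E] ++ [seq cB u | u in nbr b E]).
  by rewrite size_cat !size_image; move: degEa degEb r2; clear; lia.
rewrite mem_cat => /norP[ia ib].
have PB1 : proper_on (a |: E) r (fun u => if u == a then i else cB u).
  apply: recolor => //; first by apply: proper_on_sub PB; apply: subsetUr.
  by move=> u uE au cu; move/negP: ia; apply; rewrite -cu; apply: image_f; rewrite inE uE.
have PB2 := recolor (u := b) (i := i) PB1 ilt.
apply: (HG cA _ PA).
  rewrite /W (setUC [set a]) -setUA; apply: PB2 => u.
  case/setU1P=> [->|uE bu]; first by rewrite e_sym (negbTE nab).
  case: eqP => [ua|_ cu]; first by rewrite ua e_sym (negbTE nab) in bu.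
  by move/negP: ib; apply; rewrite -cu; apply: image_f; rewrite inE uE.
by rewrite cAa cAb /= !eqxx (negbTE ab) eqxx.
Qed.

End SetColoring.

(** * Splittings of the colors with one uncolored vertex *)

Section PartitionedColoring.
Variables (T : finType) (e : rel T).
Hypotheses (e_sym : symmetric e) (e_irr : irreflexive e).
Variables (C k : nat).
Hypothesis k_large : 4 * C + 3 <= k.
Hypothesis ncol : ~ set_colorable e setT k.
Hypothesis crit : forall x, set_colorable e (~: [set x]) k.

Implicit Types (q : T -> 'I_C.+1) (u v x y z w : T) (i j : 'I_C.+1).

(** Three is the least size for which [critical_nbrs_adj] applies. The last part takes all remaining
    colors, at least [C + 3] by [k_large]. *)
Definition psize (i : 'I_C.+1) : nat := if i < C then 3 else k - 3 * C.

Lemma psize_gt2 i : 2 < psize i.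
Proof. rewrite /psize; case: ifP => //; lia. Qed.

Lemma sum_psize : \sum_i psize i = k.
Proof.
rewrite big_ord_recr /= {2}/psize /= ltnn (eq_bigr (fun=> 3)).
  by rewrite sum_nat_const card_ord; lia.
by move=> i _; rewrite /psize /= ltn_ord.
Qed.

Definition part q i : {set T} := [set v | q v == i].

Lemma merge_parts q :
  (forall i, set_colorable e (part q i) (psize i)) -> set_colorable e setT k.
Proof.
move=> /fin_all_exists [c cP].
have ltc v : c (q v) v < psize (q v) by apply: (cP _).1; rewrite inE.
exists (fun v => 3 * q v + c (q v) v); split=> [v _|u v _ _ uv].
  move: (ltc v); rewrite /psize; have := ltn_ord (q v); case: ifP; lia.
case: (eqVneq (q u) (q v)) => [quv|/eqP quv].
  rewrite quv => /addnI; apply: (cP (q v)).2 => //; rewrite inE ?quv //.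
move=> h; apply: quv; apply: val_inj => /=.
move: (ltc u) (ltc v) h; rewrite /psize; have := ltn_ord (q u); have := ltn_ord (q v).
do 2!case: ifP; lia.
Qed.

Lemma split_coloring W : set_colorable e W k ->
  exists q, forall i, set_colorable e (W :&: part q i) (psize i).
Proof.
(* The minimum with [C] sends all colors from [3 * C] on to the last part. *)
move=> [c [cn cp]]; exists (fun v => inord (minn (c v %/ 3) C)) => i.
exists (fun v => c v - 3 * i).
have minC v : minn (c v %/ 3) C < C.+1 by rewrite ltnS geq_minr.
have itv v : v \in W :&: part (fun v => inord (minn (c v %/ 3) C)) i ->
    3 * i <= c v < 3 * i + psize i.
  rewrite !inE => /andP[/cn cv /eqP /(congr1 val)]; rewrite /= inordK // /psize => h.
  by case: ifP; move: (ltn_ord i); lia.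
split=> [v /itv|u v uW vW uv]; first by lia.
move: (itv u uW) (itv v vW); have : c u <> c v.
  by move: uW vW; rewrite !inE => /andP[uW _] /andP[vW _]; apply: cp.
lia.
Qed.

(* A state uncolors x and splits the other vertices into parts; the part
   recorded for x itself is irrelevant and may be chosen freely. *)
Definition valid x q : Prop := forall i, set_colorable e (part q i :\ x) (psize i).

(** The sum runs over ordered pairs, so each edge counts twice. *)
Definition inner_edges x q : nat :=
  \sum_(u | u != x) \sum_(v | v != x) (e u v && (q u == q v)).

Definition optimal x q : Prop :=
  valid x q /\ forall y q', valid y q' -> inner_edges x q <= inner_edges y q'.

Definition tight x q : Prop := #|nbr e x (part q (q x))| = psize (q x).

Definition upd q x i : T -> 'I_C.+1 := fun v => if v == x then i else q v.

Lemma upd_same q x i : upd q x i x = i.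
Proof. by rewrite /upd eqxx. Qed.

Lemma upd_neq q x i v : v != x -> upd q x i v = q v.
Proof. by rewrite /upd => /negbTE->. Qed.

Lemma part_upd q x i j : part (upd q x i) j :\ x = part q j :\ x.
Proof. by apply/setP=> v; rewrite !inE /upd; case: eqP. Qed.

Lemma valid_upd x q i : valid x q -> valid x (upd q x i).
Proof. by move=> V j; rewrite part_upd; apply: V. Qed.

Lemma optimal_upd x q i : optimal x q -> optimal x (upd q x i).
Proof.
move=> [V M]; split; first exact: valid_upd.
suff -> : inner_edges x (upd q x i) = inner_edges x q by [].
by apply: eq_bigr => u ux; apply: eq_bigr => v vx; rewrite !upd_neq.
Qed.

Lemma nbr_setD1 x W : nbr e x (W :\ x) = nbr e x W.
Proof.
apply/setP=> v; rewrite !inE; case: eqP => [->|//]; by rewrite e_irr !andbF.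
Qed.

Lemma nbr_upd x q i j : nbr e x (part (upd q x i) j) = nbr e x (part q j).
Proof. by rewrite -nbr_setD1 part_upd nbr_setD1. Qed.

(** The other parts keep their colorings, so coloring this one with [x] added would color the whole
    graph. *)
Lemma valid_ncol x q i : valid x q -> ~ set_colorable e (x |: (part q i :\ x)) (psize i).
Proof.
move=> V coli; apply: ncol; apply: (@merge_parts (upd q x i)) => j.
case: (eqVneq j i) => [->|ji].
  apply: set_colorable_sub coli; apply/subsetP=> v; rewrite !inE /upd.
  by case: (v == x).
apply: set_colorable_sub (V j); apply/subsetP=> v; rewrite !inE /upd.
by case: (v == x); rewrite //= eq_sym (negbTE ji).
Qed.

Lemma valid_no_free_color x q i c : valid x q ->
  proper_on e (part q i :\ x) (psize i) c ->
  ~ (exists2 a, a < psize i & forall v, v \in part q i :\ x -> e x v -> c v <> a).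
Proof.
move=> V cP free; apply: (@valid_ncol x q i V).
have [|c' c'P _] := extend_vertex e_sym e_irr cP _ free; last by exists c'.
by rewrite !inE eqxx.
Qed.

Lemma valid_deg x q i : valid x q -> psize i <= #|nbr e x (part q i)|.
Proof.
move=> V; rewrite leqNgt; apply/negP => lt; have [c cP] := V i.
apply: (valid_no_free_color V cP); apply: free_color_nbr; left.
by rewrite nbr_setD1.
Qed.

(** The left-hand side does not depend on [x], so the inner edges can be compared when only the
    uncolored vertex changes. *)
Lemma inner_edges_split x q :
  \sum_u \sum_v (e u v && (q u == q v)) =
  inner_edges x q + 2 * #|nbr e x (part q (q x))|.
Proof.
have deg_sum : \sum_v (e x v && (q x == q v)) = #|nbr e x (part q (q x))|.
  rewrite -sum1_card [RHS]big_mkcond /=; apply: eq_bigr => v _.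
  by rewrite !inE eq_sym; case: (e x v); case: eqP.
rewrite (bigD1 x) //= deg_sum (eq_bigr (fun u => (e x u && (q x == q u)) +
   \sum_(v | v != x) (e u v && (q u == q v)))); last first.
  by move=> u _; rewrite (bigD1 x) //= e_sym (eq_sym (q u)).
rewrite big_split /= -/(inner_edges x q).
have -> : \sum_(u | u != x) (e x u && (q x == q u)) = #|nbr e x (part q (q x))|.
  by rewrite -deg_sum [RHS](bigD1 x) //= e_irr.
lia.
Qed.

(** A tight [x] sees every color of its part exactly once, so it can take the color of [y].
    Uncolored, [y] has at least [psize (q x)] neighbours in that part, as many as [x], and
    minimality forces equality. *)
Lemma optimal_swap x y q : optimal x q -> tight x q -> e x y -> q y = q x ->
  optimal y q /\ tight y q.
Proof.
move=> [V M] tx xy qyx.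
have xNy := neq_of_adj e_irr xy.
have Vy : valid y q.
  move=> i; case: (eqVneq i (q x)) => [->|iq]; last first.
    suff -> : part q i :\ y = part q i :\ x by apply: V.
    apply/setP=> v; rewrite !inE; case: (eqVneq (q v) i) => [qv|]; rewrite ?andbF // !andbT.
    by apply/idP/idP => _; apply: contraNneq iq => vv; rewrite -qv vv ?qyx.
  have [c cP] := V (q x).
  have yin : y \in part q (q x) :\ x by rewrite !inE eq_sym xNy qyx eqxx.
  exists (fun v => if v == x then c y else c v).
  have -> : part q (q x) :\ y = x |: (part q (q x) :\ x :\ y).
    apply/setP=> v; rewrite !inE; case: (eqVneq v x) => [->|//].
    by rewrite xNy eqxx.
  apply: recolor => //.
  - by apply: proper_on_sub cP; apply: subsetDl.
  - by apply: cP.1.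
  move=> v; rewrite in_setD1 => /andP[vy vin] xv cvy.
  apply: (valid_no_free_color V cP); apply: free_color_nbr; right.
  rewrite nbr_setD1 tx; split=> //; split; first by have := psize_gt2 (q x); lia.
  by exists v, y; split=> //; rewrite -nbr_setD1 inE ?vin ?yin.
have dy := valid_deg (q y) Vy; rewrite qyx in dy.
have Mxy := M _ _ Vy; have Ex := inner_edges_split x q.
have Ey := inner_edges_split y q; rewrite Ex qyx tx in Ey.
split; last by rewrite /tight qyx; move: dy Mxy Ey; clear; lia.
split=> // z q' Vz; apply: leq_trans (M _ _ Vz).
by move: dy Mxy Ey; clear; lia.
Qed.

Lemma optimal_connect x z q : optimal x q -> tight x q ->
  connect [rel u v | e u v && (q u == q v)] x z ->
  [/\ optimal z q, tight z q & q z = q x].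
Proof.
move=> O t /connectP[p]; elim: p x O t => [|y p IH] x O t /=; first by move=> _ ->.
case/andP=> /andP[xy /eqP qxy] pth lst.
have [Oy ty] := optimal_swap O t xy (esym qxy).
by rewrite qxy; apply: IH.
Qed.

(** Every vertex of the component [Z] of [x] in its part can be uncolored instead of [x] and is
    tight. So [Z] is critical with degrees at most [psize (q x)], and [critical_nbrs_adj]
    applies. *)
Lemma optimal_adj x q a b : optimal x q -> tight x q ->
  e x a -> e x b -> q a = q x -> q b = q x -> a != b -> e a b.
Proof.
move=> O t xa xb qa qb ab.
pose g := [rel u v | e u v && (q u == q v)].
pose Z := [set z | connect g x z].
have ZP z : z \in Z -> [/\ optimal z q, tight z q & q z = q x].
  by rewrite inE; apply: optimal_connect.
have xZ : x \in Z by rewrite inE connect0.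
have xZn y : e x y -> q y = q x -> y \in Z.
  by move=> xy qy; rewrite inE; apply: connect1; rewrite /= xy qy eqxx.
apply: (critical_nbrs_adj e_sym e_irr (psize_gt2 (q x)) (Z := Z) (v := x)); auto.
- move=> [cA PA]; have [cB PB] := O.1 (q x).
  apply: (@valid_ncol x q (q x) O.1).
  have PB' := proper_on_sub (subsetDl _ Z) PB.
  apply: set_colorable_sub (glue e_sym PA PB' _ _).
  + apply/subsetP=> v; case/setU1P=> [->|vp]; first by rewrite in_setU xZ.
    by rewrite in_setU [_ \in _ :\: Z]in_setD vp; case: (v \in Z).
  + by move=> v vZ; rewrite in_setD vZ.
  move=> u w uZ; rewrite in_setD => /andP[wZ]; rewrite !inE => /andP[_ /eqP qw] uw.
  have [_ _ qu] := ZP u uZ; move: wZ uZ; rewrite !inE => /negP wZ xu; case: wZ.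
  by apply: connect_trans xu (connect1 _); rewrite /= uw qu qw eqxx.
- move=> y yZ; have [Oy _ qy] := ZP y yZ.
  apply: set_colorable_sub (Oy.1 (q x)); apply/subsetP=> v; rewrite !in_setD1 => /andP[-> vZ].
  by have [_ _ qv] := ZP v vZ; rewrite inE qv eqxx.
- move=> y yZ; have [_ ty qy] := ZP y yZ; rewrite -qy -ty; apply: nbr_sub.
  by apply/subsetP=> v vZ; have [_ _ qv] := ZP v vZ; rewrite inE qv qy.
Qed.

Lemma exists_optimal : exists x q, optimal x q.
Proof.
have [x _] : exists x : T, True.
  apply: contrapT => h; apply: ncol; exists (fun=> 0); split=> [v|u v]; by case: h; exists v.
have [q0 Vq0] := split_coloring (crit x).
have V0 : valid x q0.
  by move=> i; apply: set_colorable_sub (Vq0 i); apply/subsetP=> v; rewrite !inE.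
pose P n := `[< exists x q, valid x q /\ inner_edges x q = n >].
have exP : exists n, P n by exists (inner_edges x q0); apply/asboolP; exists x, q0.
case: (ex_minnP exP) => m /asboolP[y [q [V E]]] M; exists y, q; split=> // z q' V'.
by rewrite E; apply: M; apply/asboolP; exists z, q'.
Qed.

Lemma sum_deg x q : \sum_i #|nbr e x (part q i)| = #|nbr e x setT|.
Proof.
rewrite -sum1_card (partition_big q predT) //=; apply: eq_bigr => i _.
rewrite -sum1_card; apply: eq_bigl => v; rewrite !inE andTb; by rewrite andbC.
Qed.

(** * Low vertices and walks of the uncolored vertex *)

Definition low x : bool := #|nbr e x setT| == k.

(** The lower bounds of [valid_deg] already sum to [k], the degree of [x], so each of them is
    attained. *)
Lemma low_tight x q i : optimal x q -> low x -> #|nbr e x (part q i)| = psize i.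
Proof.
move=> [V _] /eqP lx; have := sum_deg x q; rewrite lx -[in RHS]sum_psize.
rewrite (bigD1 i) //= [RHS](bigD1 i) //=.
have := valid_deg i V.
have : \sum_(j | j != i) psize j <= \sum_(j | j != i) #|nbr e x (part q j)|.
  by apply: leq_sum => j _; apply: valid_deg.
move=> les lei eqs; apply/eqP; rewrite eqn_leq lei andbT.
by move: les; rewrite -(leq_add2l (psize i)) -eqs leq_add2r.
Qed.

Hypothesis low_adj : forall x y, e x y -> low x || low y.
Hypothesis deg_le : forall x, #|nbr e x setT| <= k + C.

(** At least three neighbours of [x] lie in its part, so two of them avoid [W]. These are adjacent
    by [optimal_adj], hence one is low. *)
Lemma exists_low_nbr x q (W : {set T}) : optimal x q -> tight x q -> #|W| <= 1 ->
  exists y, [/\ e x y, q y = q x, low y & y \notin W].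
Proof.
move=> O t W1; have d3 := psize_gt2 (q x); rewrite -t in d3.
pose N := nbr e x (part q (q x)) :\: W.
have N2 : 1 < #|N|.
  by rewrite /N cardsD; have := subset_leq_card (subsetIr (nbr e x (part q (q x))) W); lia.
have [a [b [aN bN ab]]] := card_gt1P N2.
move: aN bN; rewrite !inE => /andP[aW /andP[/eqP qa xa]] /andP[bW /andP[/eqP qb xb]].
have := low_adj (optimal_adj O t xa xb qa qb ab).
by case/orP=> l; [exists a | exists b].
Qed.

Lemma exists_optimal_low : exists x q, optimal x q /\ low x.
Proof.
have [x [q O]] := exists_optimal.
have [i di] : exists i, #|nbr e x (part q i)| <= psize i.
  apply: contrapT => h.
  have : \sum_i (psize i).+1 <= \sum_i #|nbr e x (part q i)|.
    by apply: leq_sum => i _; rewrite ltnNge; apply/negP => le; apply: h; exists i.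
  rewrite sum_deg (eq_bigr (fun i => psize i + 1)); last by move=> i _; rewrite addn1.
  rewrite big_split /= sum_psize sum1_card card_ord.
  by have := deg_le x; lia.
have O1 := optimal_upd i O.
have t1 : tight x (upd q x i).
  rewrite /tight upd_same nbr_upd.
  by apply/eqP; rewrite eqn_leq di; apply: valid_deg; apply: O.1.
have [|y [xy qy ly _]] := exists_low_nbr (W := set0) O1 t1; first by rewrite cards0.
exists y, (upd q x i); split=> //.
by have [] := optimal_swap O1 t1 xy qy.
Qed.

(** A low [x] is tight in every part, so it may be recorded in the part of [a] and [b]. *)
Lemma optimal_adj_low x q a b : optimal x q -> low x ->
  e x a -> e x b -> q a = q b -> a != b -> e a b.
Proof.
move=> O lx xa xb qab ab; have O' := optimal_upd (q a) O.
apply: (optimal_adj O') => //; rewrite ?upd_same ?upd_neq //.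
- by rewrite /tight low_tight.
- by rewrite eq_sym (neq_of_adj e_irr).
- by rewrite eq_sym (neq_of_adj e_irr).
Qed.

Lemma optimal_move x y q i : optimal x q -> low x -> e x y -> q y = i ->
  optimal y (upd q x i).
Proof.
move=> O lx xy qy; have O' := optimal_upd i O.
have yx : y != x by rewrite eq_sym (neq_of_adj e_irr).
have [] // := optimal_swap O' _ xy _; first by rewrite /tight low_tight.
by rewrite upd_same upd_neq.
Qed.

(* A walk moves the uncolored vertex alternately into the parts i and j, each
   time releasing a low vertex x of the clique it joins.  F consists of x0 and
   all cliques joined before the last one; the last one is the set of neighbours of
   x in its own part, and y is the vertex that joined it.  The invariants say
   that a vertex that joined an earlier clique has no neighbours in the parts i
   and j outside F and B, so the walk can never return to F; as F grows, the
   walk must enter B at some point, and then b0 is adjacent to a0. *)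
Lemma walk_stops i j x0 a0 b0 (B : {set T}) : i != j ->
  e x0 a0 -> e x0 b0 -> ~~ e b0 a0 -> low b0 -> b0 \in B ->
  (forall b b', b \in B -> b' \in B -> b != b' -> e b b') ->
  forall x y q c (F : {set T}),
  optimal x q -> low x -> q y = q x ->
  (q x = i /\ c = j \/ q x = j /\ c = i) ->
  e x y -> y \in F -> x \notin F -> x \notin B ->
  (forall v, v \in F -> exists u, [/\ u \in F, q u = q v, u = v \/ e u v &
     u = y \/ forall w, e u w -> q w = i \/ q w = j -> w \in F :|: B]) ->
  (forall w, e y w -> q w = i \/ q w = j ->
     w \in F :|: B \/ q w = q x /\ (w = x \/ e x w)) ->
  (forall b, b \in B -> q b = j) ->
  x0 \in F -> q x0 = i -> q a0 = i -> (a0 \in F \/ q x = i /\ e x a0) ->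
  False.
Proof.
move=> ij xa0 xb0 /negP nba lb0 b0B Bclq x y q c F.
(* The complement of [F] shrinks at each move, since [x] enters [F]. *)
elim: {F}_.+1 {-2}F (ltnSn #|~: F|) x y q c => // m IH F Fm x y q c.
move=> O lx qyx qxc xy yF xF xB I3 I2 qB x0F qx0 qa0 I6.
have cx : c != q x by case: qxc => -[-> ->] //; rewrite eq_sym.
have qxij : q x = i \/ q x = j by case: qxc => -[]; auto.
pose q' := upd q x c.
have O' : optimal x q' by apply: optimal_upd.
have t' : tight x q' by rewrite /tight low_tight.
have [|x' [xx' qx' lx' _]] := exists_low_nbr (W := set0) O' t'; first by rewrite cards0.
have x'x : x' != x by rewrite eq_sym (neq_of_adj e_irr).
have neqF v : v \in F -> v != x by apply: contraTneq => ->.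
have q'F v : v \in F -> q' v = q v by move=> vF; rewrite /q' upd_neq ?neqF.
have q'x : q' x = c by rewrite /q' upd_same.
have qx'c : q x' = c by move: qx'; rewrite q'x /q' upd_neq.
have a0x : a0 != x.
  by case: I6 => [/neqF //|[_ h]]; rewrite eq_sym (neq_of_adj e_irr).
have Ox' : optimal x' q' by apply: optimal_move.
(* When the walk enters [B], release [b0] in place of [x'], move it to part [i] and release [x0]
   there: then [b0] and [a0] are neighbours of [x0] in one part. *)
case: (boolP (x' \in B)) => x'B.
  have cj : c = j by rewrite -qx'c qB.
  have b0x : b0 != x by apply: contraNneq xB => <-.
  have q'b0 : q' b0 = j by rewrite /q' upd_neq ?qB.
  have xb : e x b0.
    case: (eqVneq x' b0) => [<-//|x'b].
    apply: (optimal_adj_low Ox' lx'); rewrite ?q'x ?q'b0 ?cj 1?e_sym //.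
      by rewrite e_sym Bclq.
    by rewrite eq_sym.
  have Ob : optimal b0 q'.
    suff -> : q' = upd q x j by apply: optimal_move => //; apply: qB.
    by rewrite /q' cj.
  have q'x0 : q' x0 = i by rewrite q'F.
  apply: nba; pose q'' := upd q' b0 i.
  have Ox0 : optimal x0 q'' by apply: optimal_move; rewrite // e_sym.
  have b0x0 : x0 != b0 by apply: (neq_of_adj e_irr).
  have a0b0 : a0 != b0 by apply: contraNneq ij => h; rewrite -qa0 h qB.
  have q''x0 : q'' x0 = i by rewrite /q'' upd_neq.
  have t'' : tight x0 q''.
    have t1 : tight b0 q'' by rewrite /tight low_tight //; apply: optimal_upd.
    have [] // := @optimal_swap b0 x0 q'' (optimal_upd i Ob) t1; first by rewrite e_sym.
    by rewrite q''x0 /q'' upd_same.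
  apply: (optimal_adj Ox0 t'') => //; rewrite ?q''x0 /q'' ?upd_same //.
    by rewrite upd_neq // /q' upd_neq.
  by rewrite eq_sym.
pose F' := F :|: [set v | (q v == q x) && ((v == x) || e x v)].
have sFF' v : v \in F -> v \in F' by rewrite in_setU => ->.
have xF' : x \in F' by rewrite !inE !eqxx orbT.
have inF' w : q w = q x -> w = x \/ e x w -> w \in F'.
  by move=> qw h; rewrite !inE qw eqxx /=; case: h => ->; rewrite ?eqxx ?orbT.
have q'ij w : q' w = i \/ q' w = j -> q w = i \/ q w = j.
  by case: (eqVneq w x) => [->//|wx]; rewrite /q' upd_neq.
have yN w : e y w -> q' w = i \/ q' w = j -> w \in F' :|: B.
  move=> yw /q'ij qw; rewrite in_setU.
  case: (I2 w yw qw) => [|[qwx h]]; last by rewrite inF'.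
  by rewrite in_setU => /orP[/sFF' ->|->]; rewrite ?orbT.
apply: (IH F' _ x' x q' (q x)) => //; rewrite ?qx' ?q'x //.
- apply: leq_trans (_ : #|~: F| <= m); last by rewrite -ltnS.
  apply: proper_card; apply/properP; split.
    by rewrite setCS subsetUl.
  by exists x; rewrite ?inE ?xF ?eqxx ?orbT.
- by case: qxc => -[-> ->]; auto.
- by rewrite e_sym.
(* If the walk returned to [F], the vertex [u] given by [I3] would be adjacent to [x], forcing [x]
   into [F] or [B]. *)
- apply/negP; rewrite in_setU inE qx'c (negbTE cx) orbF => x'F.
  have [u [uF qu ux' Hu]] := I3 x' x'F.
  have xu : e x u.
    case: (eqVneq u x') => [->//|unx'].
    have ux'' : e u x' by case: ux' => // h; rewrite h eqxx in unx'.
    apply: (optimal_adj_low Ox' lx'); rewrite 1?e_sym // ?q'x ?q'F ?qu ?qx'c //.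
    by rewrite eq_sym neqF.
  case: Hu => [uy|/(_ x)]; first by move: cx; rewrite -qx'c -qu uy qyx eqxx.
  by rewrite e_sym xu in_setU (negbTE xF) (negbTE xB) => /(_ isT qxij).
- move=> v; rewrite in_setU => /orP[vF|].
    have [u [uF qu uv Hu]] := I3 v vF.
    exists u; split=> //; [exact: sFF' | by rewrite !q'F | right].
    case: Hu => [->|Hu]; first exact: yN.
    move=> w uw /q'ij qw; have := Hu w uw qw; rewrite !in_setU -/F'.
    by case/orP=> [->|->]; rewrite ?orbT.
  rewrite inE => /andP[/eqP qv /orP[/eqP->|xv]].
    by exists x; split=> //; left.
  have vx : v != x by rewrite eq_sym (neq_of_adj e_irr).
  (* [y] serves for the other vertices of the clique of [x], because [yN] now confines its
     neighbours. *)
  exists y; split; [exact: sFF' | | | by right].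
    by rewrite q'F // /q' upd_neq ?qv.
  case: (eqVneq y v) => [->|yv]; first by left.
  by right; apply: (optimal_adj_low O lx) => //; rewrite qv.
- move=> w xw /q'ij qw.
  have wx : w != x by rewrite eq_sym (neq_of_adj e_irr).
  case: (eqVneq (q w) (q x)) => [qwx|qwx].
    by left; rewrite in_setU inF' //; right.
  have qwc : q w = c by move: qwx qw; case: qxc => -[-> ->] /eqP; intuition.
  right; split; first by rewrite /q' upd_neq.
  case: (eqVneq w x') => [->|wx']; first by left.
  by right; apply: (optimal_adj_low O lx); rewrite ?qx'c 1?eq_sym.
- by move=> b bB; rewrite /q' upd_neq ?qB //; apply: contraNneq xB => <-.
- exact: sFF'.
- by rewrite q'F.
- by rewrite /q' upd_neq.
- left; case: I6 => [/sFF' //|[qxi xa]]; apply: inF'; last by right.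
  by rewrite qa0 qxi.
Qed.

(** Within one part, [optimal_adj_low] suffices. Otherwise [x] moves to the part of [v] and releases
    a low vertex [x1] other than [v]; if [u] and [v] were not adjacent, the walk from [x1] would
    contradict [walk_stops]. *)
Lemma low_nbrs_adj x q u v : optimal x q -> low x ->
  e x u -> e x v -> u != v -> low u -> e u v.
Proof.
move=> O lx xu xv uv lu.
case: (eqVneq (q u) (q v)) => [quv|quv]; first exact: optimal_adj_low O lx _ _ _ _.
pose q0 := upd q x (q v).
have O0 : optimal x q0 by apply: optimal_upd.
have t0 : tight x q0 by rewrite /tight low_tight.
have q0n w : e x w -> q0 w = q w.
  by move=> xw; rewrite /q0 upd_neq // eq_sym (neq_of_adj e_irr).
have q0x : q0 x = q v by rewrite /q0 upd_same.
have [|x1 [xx1 qx1 lx1]] := exists_low_nbr (W := [set v]) O0 t0; first by rewrite cards1.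
rewrite inE => x1v.
have [O1 t1] := optimal_swap O0 t0 xx1 qx1.
apply/negPn/negP => nuv.
rewrite q0x in qx1.
have adj1 w : e x w -> q w = q v -> w = x1 \/ e x1 w.
  move=> xw qw; case: (eqVneq w x1) => [->|wx1]; first by left.
  right; apply: (optimal_adj_low O0 lx) => //; first by rewrite qx1 q0n.
  by rewrite eq_sym.
(* Initially [F] is just [[set x]], [B] consists of the neighbours of [x] in the part of [u], and
   [v] lies in the clique of [x1]. *)
apply: (@walk_stops (q v) (q u) x v u (nbr e x (part q (q u))) _ _ _ nuv lu _ _
  x1 x q0 (q u) [set x]) => //; rewrite ?inE ?q0x ?qx1 ?q0n ?eqxx ?xu //.
- by rewrite eq_sym.
- move=> b b'; rewrite !inE => /andP[/eqP qb xb] /andP[/eqP qb' xb'].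
  by apply: (optimal_adj_low O lx) => //; rewrite qb.
- by left.
- by rewrite e_sym.
- by rewrite eq_sym (neq_of_adj e_irr).
- by rewrite -(q0n x1) // qx1 eq_sym (negbTE quv).
- by move=> w /set1P->; exists x; split; rewrite ?inE; auto.
- move=> w xw; rewrite !inE q0n // xw andbT => -[qw|->]; last by left; rewrite eqxx orbT.
  by right; split=> //; apply: adj1.
- by move=> b; rewrite !inE => /andP[/eqP qb xb]; rewrite q0n.
right; split=> //.
by case: (adj1 v xv erefl) => // h; rewrite h eqxx in x1v.
Qed.

(** * The closed neighbourhood of a low vertex *)

Lemma vertex_critical_clique : exists S : {set T},
  #|S| = k.+1 /\ forall u v, u \in S -> v \in S -> u != v -> e u v.
Proof.
have [x [q [O lx]]] := exists_optimal_low.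
pose N := nbr e x setT; pose M := x |: N.
have NE v : (v \in N) = e x v by rewrite !inE.
have xN : x \notin N by rewrite NE e_irr.
have cardN : #|N| = k by apply/eqP.
have cardM : #|M| = k.+1 by rewrite cardsU1 xN cardN.
have Madj u v : u \in M -> v \in M -> u != v -> low u -> e u v.
  rewrite !in_setU1 !NE => /orP[/eqP->|xu] /orP[/eqP->|xv] uv lu; rewrite ?eqxx // in uv *.
    by rewrite e_sym.
  exact: low_nbrs_adj O lx xu xv uv lu.
pose H := [set v in M | ~~ low v].
have HM : H \subset M by apply/subsetP=> v; rewrite inE => /andP[].
have HN v : v \in H -> e x v.
  by rewrite inE in_setU1 NE => /andP[/orP[/eqP->|//]]; rewrite lx.
have Hind u v : u \in H -> v \in H -> e u v = false.
  rewrite !inE => /andP[_ /negbTE lu] /andP[_ /negbTE lv]; apply/negP => /low_adj.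
  by rewrite lu lv.
case: (leqP #|H| 1) => [H1|/card_gt1P[t1 [t2 [t1H t2H t12]]]].
  exists M; split=> // u v uM vM uv.
  case: (boolP (low u)) => lu; first exact: Madj.
  case: (boolP (low v)) => lv; first by rewrite e_sym; apply: Madj; rewrite // eq_sym.
  move: H1; rewrite leqNgt => /negP[]; apply/card_gt1P; exists u, v.
  by rewrite [u \in H]in_set [v \in H]in_set uM vM.
case: ncol.
(* Two vertices of [H] in one part would be adjacent, so each part holds at most one. *)
have cardH : #|H| <= C.+1.
  rewrite -(card_ord C.+1) -(card_in_imset (f := q)) ?max_card //.
  move=> u v uH vH quv; apply/eqP/negPn/negP => uv.
  have := Hind u v uH vH; rewrite (optimal_adj_low O lx) //; exact: HN.
pose Q := M :\: H.
have Qlow u : u \in Q -> low u.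
  by rewrite in_setD [u \in H]inE => /andP[]; case: (u \in M) => //=; rewrite negbK.
have cardQ : #|Q| + #|H| = k.+1.
  by rewrite -cardM -(cardsID H M) (setIidPr HM) addnC.
pose R := ~: M.
(* [t] has degree at most [k + C] and is adjacent to all of [Q], which has at least [k - C]
   vertices. *)
have degR t : t \in H -> #|nbr e t R| <= 2 * C.
  move=> tH; have tM := subsetP HM _ tH.
  have dis : #|nbr e t R| + #|Q| <= #|nbr e t setT|.
    have QR : nbr e t R :&: Q = set0.
      apply/setP=> u; rewrite in_set0; apply/negP => /setIP[].
      by rewrite inE in_setC in_setD => /andP[/negbTE-> _]; rewrite andbF.
    rewrite -cardsUI QR cards0 addn0; apply/subset_leq_card/subsetP=> u.
    rewrite in_setU => /orP[|uQ]; first by rewrite !inE => /andP[_ ->].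
    have [uM uH] := setDP uQ.
    by rewrite inE in_setT e_sym Madj ?Qlow //; apply: contraNneq uH => ->.
  move: dis cardQ cardH (deg_le t); clear; lia.
have [c0 P0] : set_colorable e R k.
  by apply: set_colorable_sub (crit x); rewrite setCS sub1set setU11.
have HR u : u \in H -> u \notin R by move=> uH; rewrite in_setC negbK (subsetP HM).
(* The two lists exclude at most [4 * C] colors, fewer than [k]. *)
have [|a ak] := @free_color k ([seq c0 u | u in nbr e t1 R] ++ [seq c0 u | u in nbr e t2 R]).
  rewrite size_cat !size_image; move: (degR _ t1H) (degR _ t2H) k_large; clear; lia.
rewrite mem_cat => /norP[a1 a2].
have P1 := recolor e_sym e_irr (u := t1) P0 ak.
have {}P1 : proper_on e (t1 |: R) k (fun v => if v == t1 then a else c0 v).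
  apply: P1 => u uR t1u cu; move/negP: a1; apply.
  by rewrite -cu; apply: image_f; rewrite inE uR.
have P2 := recolor e_sym e_irr (u := t2) P1 ak.
set c2 := (fun v : T => _) in P2.
have {}P2 : proper_on e (t2 |: (t1 |: R)) k c2.
  apply: P2 => u; rewrite in_setU1 => /orP[/eqP->|uR t2u]; first by rewrite Hind.
  case: eqP => [ut|_ cu]; first by rewrite ut Hind in t2u.
  by move/negP: a2; apply; rewrite -cu; apply: image_f; rewrite inE uR.
have c2t : c2 t1 = c2 t2 by rewrite /c2 (negbTE t12) !eqxx.
have k0 : 0 < k by move: k_large; clear; lia.
have [||c3 P3 c3E] := extend_set e_sym e_irr (S := H :\ t1 :\ t2) P2 k0.
- move=> u /setD1P[ut2 /setD1P[ut1 uH]].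
  by rewrite !in_setU1 (negbTE ut1) (negbTE ut2) HR.
- move=> u /setD1P[ut2 /setD1P[ut1 uH]]; left.
  apply: leq_ltn_trans (_ : #|nbr e u R| < k); last first.
    by move: (degR u uH) k_large; clear; lia.
  apply/subset_leq_card/subsetP=> v; rewrite [v \in nbr _ _ _]inE => /andP[vin uv].
  have vH : v \notin H by apply: contraTN uv => vH; rewrite Hind.
  rewrite inE uv andbT; move: vin; rewrite in_setU !in_setU1 !in_setD1 (negbTE vH) !andbF orbF.
  by case: eqP vH => [->|_]; rewrite ?t2H //; case: eqP => [->|_]; rewrite ?t1H.
(* A vertex of [Q] has degree [k] and sees [t1] and [t2] in the same color, so a color stays free
   for it. *)
have [||c4 P4 _] := extend_set e_sym e_irr (S := Q) P3 k0.
- move=> u /setDP[uM uH]; rewrite in_setU !in_setU1 !in_setD1 (negbTE uH) !andbF orbF.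
  rewrite in_setC uM orbF; apply/negP => /orP[]/eqP h; by rewrite h ?t1H ?t2H in uH.
- move=> u uQ; right; have [uM uH] := setDP uQ.
  have adjt t : t \in H -> e u t.
    move=> tH; apply: Madj => //; [exact: (subsetP HM) | | exact: Qlow].
    by apply: contraNneq uH => ->.
  split.
    by have /eqP <- := Qlow u uQ; apply: nbr_sub; apply: subsetT.
  exists t1, t2; split=> //.
  + by rewrite inE adjt // !inE eqxx !orbT.
  + by rewrite inE adjt // !inE eqxx.
  by rewrite !c3E // !inE eqxx ?orbT.
exists c4; apply: proper_on_sub P4; apply/subsetP=> v _.
rewrite !in_setU !in_set1 !in_setD1 in_setD in_setC.
by case: (v \in M) (v \in H) => -[]; case: eqP => //=; case: eqP.
Qed.

End PartitionedColoring.

(** * Reduction to a critical induced subgraph *)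

Lemma clique_of_uncolorable (T : finType) (e : rel T) (C k : nat) :
  simple_graph e -> 4 * C + 3 <= k -> ~ set_colorable e setT k ->
  (forall x y, e x y -> k <= deg e x -> k <= deg e y ->
     (deg e x = k \/ deg e y = k) /\ deg e x <= k + C) ->
  exists S : {set T}, #|S| = k.+1 /\ clique e S.
Proof.
move=> [e_sym e_irr] kC ncol edge.
have k0 : 0 < k by move: kC; clear; lia.
pose P := [pred X : {set T} | `[< ~ set_colorable e X k >]].
have [X /minsetP[/asboolP nX minX] _] := minset_exists (asboolT ncol : P setT).
(* [vertex_critical_clique] concerns graphs on a whole type, hence the subtype of [X]. *)
pose U : finType := {x : T | x \in X}; pose f : rel U := [rel u v : U | e (val u) (val v)].
have f_sym : symmetric f by move=> u v; apply: e_sym.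
have f_irr : irreflexive f by move=> u; apply: e_irr.
have nU : ~ set_colorable f setT k.
  move=> [c [cn cp]]; apply: nX; exists (fun x => if insub x is Some u then c u else 0).
  split=> [x xX|x y xX yX xy]; first by rewrite insubT; apply: cn.
  by rewrite !insubT; apply: cp.
have critU u : set_colorable f (~: [set u]) k.
  have [c [cn cp]] : set_colorable e (X :\ val u) k.
    apply: contrapT => /asboolP h.
    by have /setP/(_ (val u)) := minX _ h (subsetDl _ _); rewrite !inE eqxx (valP u).
  have uX v : v \in ~: [set u] -> val v \in X :\ val u.
    by rewrite !inE (valP v) andbT.
  exists (c \o val); split=> [v /uX|v w /uX vX /uX wX]; first exact: cn.
  exact: cp.
have degU u : #|nbr f u setT| <= deg e (val u).
  rewrite -(card_imset _ val_inj); apply/subset_leq_card/subsetP=> _ /imsetP[v vu ->].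
  by move: vu; rewrite !inE.
have kdegU u : k <= #|nbr f u setT|.
  rewrite leqNgt; apply/negP => lt; have [c cP] := critU u; apply: nU.
  have [||c' c'P _] := extend_vertex f_sym f_irr (u := u) cP.
  - by rewrite !inE eqxx.
  - apply: free_color_nbr; left; apply: leq_ltn_trans lt.
    by apply: nbr_sub; apply: subsetT.
  by apply: set_colorable_sub (ex_intro _ c' c'P); rewrite setUCr.
have kdeg (u : U) : k <= deg e (val u) by apply: leq_trans (kdegU u) (degU u).
have [||S [cardS Sadj]] := vertex_critical_clique f_sym f_irr kC nU critU.
(* Degrees in [f] lie between [k] and those in [e], so a degree [k] in [e] remains [k]. *)
- move=> u v uv; have [+ _] := edge _ _ uv (kdeg u) (kdeg v).
  have := degU u; have := degU v.
  move=> degv degu [] h; rewrite /low !eqn_leq !kdegU ?andbT.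
  + by rewrite -h degu.
  + by rewrite -h degv orbT.
- move=> u; apply: leq_trans (degU u) _.
  (* The hypothesis [edge] bounds degrees only at ends of edges, so a neighbour of [u] is needed. *)
  have /card_gt0P[v] : 0 < #|nbr f u setT| by apply: leq_trans k0 (kdegU u).
  by rewrite !inE => uv; have [] := edge _ _ uv (kdeg u) (kdeg v).
exists (val @: S); split; first by rewrite card_imset //; apply: val_inj.
apply/forall_inP=> _ /imsetP[u uS ->]; apply/forall_inP=> _ /imsetP[v vS ->].
by apply/implyP => uv; apply: Sadj => //; apply: contraNneq uv => ->.
Qed.

Lemma set_colorable_colorable (T : finType) (e : rel T) k :
  set_colorable e setT k -> colorable e k.
Proof.
move=> [c [cn cp]]; apply/existsP.
exists [ffun x => Ordinal (cn x (in_setT x))]; apply/forallP=> x; apply/forallP=> y.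
by apply/implyP=> xy; rewrite !ffunE; apply/eqP => -[]; apply: cp.
Qed.

Local Open Scope ring_scope.

(** The untruncated value at the edge is below [k + 1]. Two degrees above [k] would bring it to
    [k + 1], and so would one above [k + C] with [C] the truncation of [1 / eps], since
    [eps * (C + 1) > 1]. *)
Lemma Delta_eps_edge (R : realType) (eps : R) (T : finType) (e : rel T) (k : nat) x y :
  symmetric e -> 0 < eps -> eps <= 1 -> (Delta_eps eps e <= k)%N ->
  e x y -> (k <= deg e x)%N -> (k <= deg e y)%N ->
  (deg e x = k \/ deg e y = k) /\ (deg e x <= k + Num.truncn eps^-1)%N.
Proof.
move=> e_sym eps0 eps1 Dk xy kx ky.
set m := minn (deg e x) (deg e y); set M := maxn (deg e x) (deg e y).
have km : (k <= m)%N by rewrite leq_min kx.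
have mM : (m <= M)%N by rewrite /m /M geq_min !leq_max leqnn.
have ltk : (1 - eps) * m%:R + eps * M%:R < k.+1%:R.
  apply: lt_le_trans (truncnS_gt _) _; rewrite ler_nat ltnS.
  by apply: leq_trans Dk; rewrite /Delta_eps (bigD1 (x, y)) //= leq_maxl.
have mk : (m <= k)%N.
  rewrite leqNgt; apply/negP => km1; move: ltk; rewrite ltNge => /negP; apply.
  have h1 : k.+1%:R <= m%:R :> R by rewrite ler_nat.
  have h2 : m%:R <= M%:R :> R by rewrite ler_nat.
  nra.
have Mk : (M <= k + Num.truncn eps^-1)%N.
  rewrite leqNgt; apply/negP => kM; move: ltk; rewrite ltNge => /negP; apply.
  have h1 : k%:R <= m%:R :> R by rewrite ler_nat.
  have h2 : k%:R + (Num.truncn eps^-1).+1%:R <= M%:R :> R by rewrite -natrD ler_nat addnS.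
  have h3 := truncnS_gt eps^-1.
  have h4 : 1 < eps * (Num.truncn eps^-1).+1%:R by rewrite mulrC -ltr_pdivrMr // div1r.
  rewrite -natr1; nra.
split; last by apply: leq_trans Mk; apply: leq_maxl.
by move: mk km; rewrite /m /minn; case: ifP => _ mk km; [left | right]; apply/eqP; rewrite eqn_leq mk km.
Qed.

Theorem theorem1p3 (R : realType) (eps : R) :
  0 < eps -> eps <= 1 ->
  exists t : nat,
    forall (T : finType) (e : rel T),
      simple_graph e ->
      (t <= Delta_eps eps e)%N ->
      (chi e <= maxn (omega e) (Delta_eps eps e))%N.
Proof.
move=> eps0 eps1; pose C := Num.truncn eps^-1.
(* The last part needs [3 <= k - 3 * C], and a common color for two high vertices needs [4 * C < k];
   this threshold gives both. *)
exists (4 * C + 3)%N => T e simple_e large.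
set k := maxn _ _.
have kC : (4 * C + 3 <= k)%N by rewrite leq_max large orbT.
suff col : colorable e k.
  apply/bigmax_leqP => i /andP[_ /forallP ncol]; rewrite leqNgt; apply/negP => ki.
  by have := ncol (Ordinal ki); rewrite /= col.
apply: set_colorable_colorable; apply: contrapT => ncol.
have [|S [cardS cliqueS]] := clique_of_uncolorable simple_e kC ncol.
  move=> x y; apply: Delta_eps_edge => //; [exact: simple_e.1 | exact: leq_maxr].
have : (#|S| <= omega e)%N by rewrite /omega (bigD1 S) //= leq_maxl.
by rewrite cardS ltnNge leq_maxl.
Qed.
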